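(* Let $Y$ be a Poisson random variable with parameter $\alpha>0$, let $0<q<1$, $x\in[0,1]$, and let $n,r$ be integers with $0\le r\le n$. Then $$B_{r,n}^{Y}(x,q)=\binom{n}{r}[x]_q^{r}\,\phi_{n-r}\bigl(\alpha(1-[x]_{q^{-1}})\bigr).$$
   Context: $q$-numbers: $[x]_q=\frac{q^x-1}{q-1}$ and $[x]_{q^{-1}}=\frac{q^{-x}-1}{q^{-1}-1}$; one has $[1-x]_q=1-[x]_{q^{-1}}$. Probabilistic $q$-Bernstein polynomials $B_{r,n}^Y(x,q)$ associated with $Y$: $\sum_{n=r}^{\infty}B_{r,n}^{Y}(x,q)\frac{v^n}{n!}=\frac{(v[x]_q)^r}{r!}\left(\mathrm{E}[e^{vY}]\right)^{[1-x]_q}$, where the power is the power series in $v$ with constant term $1$. For $Y\sim \mathrm{Poisson}(\alpha)$, $P(Y=y)=e^{-\alpha}\alpha^y/y!$ and $\mathrm{E}[e^{vY}]=e^{\alpha(e^v-1)}$. Bell polynomials: $\sum_{n=0}^{\infty}\phi_n(z)\frac{v^n}{n!}=e^{z(e^v-1)}$. *)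

(* Defs.v *)
From HB Require Import structures.
From mathcomp Require Import all_boot all_order all_algebra.
From mathcomp Require Import all_classical all_reals all_analysis.

Set Implicit Arguments.
Unset Strict Implicit.
Unset Printing Implicit Defensive.

Import Order.TTheory GRing.Theory Num.Theory.
Import numFieldNormedType.Exports.

Local Open Scope classical_set_scope.
Local Open Scope ring_scope.

(* [x]_q = (q^x - 1) / (q - 1), for q > 0 and a real exponent x. *)
Definition qnum (R : realType) (q x : R) : R := (q `^ x - 1) / (q - 1).

(* The identity  sum_(n >= r) c_n v^n / n! = f(v)  between a convergent power
   series in v and f, on a neighbourhood of v = 0. *)
Definition is_egf (R : realType) (r : nat) (c : nat -> R) (f : R -> R) : Prop :=
  \forall v \near (0 : R),
    (fun N : nat => \sum_(r <= n < N) c n * (v ^+ n / n`!%:R)) @ \oo --> f v.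

(* The right-hand side of the generating function of B_{r,n}^Y(x,q), as a
   function of v. As E[e^{vY}] is positive and equal to 1 at v = 0, its real
   power is near v = 0 the sum of the power series with constant term 1. Taking
   [fine] of the extended-real expectation is harmless as soon as E[e^{vY}] is
   finite near v = 0. *)
Definition bernstein_gen (d : measure_display) (T : measurableType d)
    (R : realType) (P : probability T R) (Y : T -> R) (r : nat) (x q v : R) : R :=
  (v * qnum q x) ^+ r / r`!%:R * (fine ('M_P Y v)) `^ (qnum q (1 - x)).

(* B_{r,n}^Y(x,q). A sequence satisfying the defining identity is unique for
   n >= r; its terms with n < r are unconstrained. *)
Definition prob_qbernstein (d : measure_display) (T : measurableType d)
    (R : realType) (P : probability T R) (Y : T -> R) (r n : nat) (x q : R) : R :=
  xget (fun=> 0)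
    [set c : nat -> R | is_egf r c (bernstein_gen P Y r x q)] n.

Definition bell_poly (R : realType) (n : nat) : {poly R} :=
  xget (fun=> 0)
    [set p : nat -> {poly R} | forall z : R,
       is_egf 0 (fun k => (p k).[z]) (fun v => expR (z * (expR v - 1)))] n.

Definition is_poisson (d : measure_display) (T : measurableType d)
    (R : realType) (P : probability T R) (Y : {RV P >-> R}) (alpha : R) : Prop :=
  forall k : nat, pmf Y k%:R = poisson_pmf alpha k.

(* Main.v *)
(** A Poisson variable is almost surely a natural number, so summing over the
    events [Y = k] gives [E[e^(vY)] = e^(alpha (e^v - 1))], and the
    [[1-x]_q]-th power of this is the Bell generating function at
    [alpha [1-x]_q]. Multiplying by [(v [x]_q)^r / r!] only shifts its
    coefficients, and the coefficients of a convergent power series are unique.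
    The Bell generating function is indeed a convergent power series near 0:
    its n-th derivative at [t] is [phi_n(z e^t) e^(z (e^t - 1))], where
    [phi_(n+1) = X (phi_n + phi_n')] (Touchard's recurrence), and this grows at
    most like [C^n n!] on [[-1, 1]], so the Taylor remainders tend to 0. *)
Require Import Defs.
From HB Require Import structures.
From mathcomp Require Import all_boot all_order all_algebra.
From mathcomp Require Import all_classical all_reals all_analysis.
From mathcomp Require Import measurable_realfun ring lra.
Import Order.TTheory GRing.Theory Num.Theory.
Import numFieldNormedType.Exports.
Local Open Scope classical_set_scope.
Local Open Scope ring_scope.

(** * Taylor expansion with Cauchy remainder *)

(* Following the Taylor sum along the segment [s |-> s v] treats both signs of
   [v] at once. *)
Lemma is_derive_taylor_sum (R : realType) (f : nat -> R -> R) (v : R) :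
  (forall k (t : R), is_derive t 1 (f k) (f k.+1 t)) ->
  forall N (s : R), is_derive s 1
    (fun s : R => \sum_(k < N.+1) f k (s * v) * (((1 - s) * v) ^+ k / k`!%:R))
    (v * f N.+1 (s * v) * (((1 - s) * v) ^+ N / N`!%:R)).
Proof.
move=> df; have dfv k (s : R) : is_derive s 1 (fun s : R => f k (s * v)) (v * f k.+1 (s * v)).
  have dl : is_derive s 1 (fun s : R => s * v) v.
    by apply: is_derive_eq; rewrite /GRing.scale /=; ring.
  by rewrite mulrC; exact: is_derive1_comp.
elim=> [|N IH] s.
  under eq_fun do rewrite big_ord1 expr0 fact0 divr1 mulr1.
  by rewrite expr0 fact0 divr1 mulr1.
under eq_fun do rewrite big_ord_recr /=.
(* The factor [- v] makes the derivative of the new term cancel the remainder from the induction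
   hypothesis, so the sum telescopes. *)
have dp : is_derive s 1 (fun s : R => ((1 - s) * v) ^+ N.+1 / N.+1`!%:R)
    (- v * (((1 - s) * v) ^+ N / N`!%:R)).
  have dl : is_derive s 1 (fun s : R => (1 - s) * v) (- v).
    by apply: is_derive_eq; rewrite /GRing.scale /=; ring.
  have dX := @is_deriveX _ _ _ N.+1 s 1 _ dl; rewrite exprfctE in dX.
  have dM := is_deriveM dX (is_derive_cst (N.+1`!%:R^-1 : R) s (1 : R)).
  apply: is_derive_eq.
  rewrite /GRing.scale /= factS natrM.
  have : (N.+1%:R : R) != 0 by rewrite pnatr_eq0.
  have : (N`!%:R : R) != 0 by rewrite pnatr_eq0 -lt0n fact_gt0.
  move: (N.+1%:R) (N`!%:R) => a b b0 a0; field; exact/andP.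
apply: is_derive_eq.
by rewrite /GRing.scale /=; ring.
Qed.

(** The mean value theorem for the Taylor sum on [[0, 1]]: at [s = 1] only the term [k = 0]
    survives, and at [s = 0] the sum is the Taylor polynomial at 0. *)
Lemma taylor_lagrange (R : realType) (f : nat -> R -> R) (v : R) (N : nat) :
  (forall k (t : R), is_derive t 1 (f k) (f k.+1 t)) ->
  exists2 s, s \in `]0, 1[ &
    f 0 v - \sum_(k < N.+1) f k 0 * (v ^+ k / k`!%:R) =
    v * f N.+1 (s * v) * (((1 - s) * v) ^+ N / N`!%:R).
Proof.
move=> df; have dh := @is_derive_taylor_sum R f v df N.
have [s s01 hs] := @MVT R _ _ 0 1 ltr01 (fun s _ => dh s)
  (derivable_within_continuous (fun s _ => @ex_derive _ _ _ _ _ _ _ (dh s))).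
have {}hs := etrans hs (etrans (congr1 _ (subr0 1)) (mulr1 _)).
exists s => //; rewrite -hs; congr (_ - _).
  rewrite big_ord_recl mul1r expr0 fact0 divr1 mulr1 big1 ?addr0// => i _.
  by rewrite subrr mul0r expr0n /= mul0r mulr0.
by apply: eq_bigr => i _; rewrite mul0r subr0 mul1r.
Qed.

Lemma is_egf_derivatives (R : realType) (f : nat -> R -> R) (K C : R) :
  1 <= C -> (forall k (t : R), is_derive t 1 (f k) (f k.+1 t)) ->
  (forall n t, `|t| <= 1 -> `|f n t| <= K * C ^+ n * n`!%:R) ->
  is_egf 0 (f ^~ 0) (f 0).
Proof.
move=> C1 df fb; have C0 : 0 < C by exact: lt_le_trans C1.
have K0 : 0 <= K.
  have := fb 0 0; rewrite normr0 ler01 expr0 fact0 !mulr1 => /(_ isT).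
  exact: le_trans.
rewrite /is_egf; near=> v.
(* With 1/4, the factor [N.+1 <= 2 ^+ N] of the Cauchy remainder is absorbed and a bound
   [K * 2^-1 ^+ N] is left. *)
have vC : C * `|v| <= 4^-1.
  rewrite -ler_pdivlMl//; near: v; apply: (@nbhs0_le R R).
  by rewrite mulr_gt0// invr_gt0.
have v1 : `|v| <= 1.
  apply: (@le_trans _ _ (C * `|v|)); first by rewrite ler_peMl.
  by apply: le_trans vC _; lra.
rewrite -(cvg_shiftS (fun N => \sum_(0 <= n < N) f n 0 * (v ^+ n / n`!%:R))) /=.
apply/cvgrPdist_le => e e0.
have g0 : K * (2^-1) ^+ N @[N --> \oo] --> (0 : R).
  rewrite -[0](mulr0 K); apply: cvgMl_tmp; apply: cvg_expr.
  by rewrite ger0_norm ?invr_ge0//; lra.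
near=> N; rewrite big_mkord.
have [s s01 ->] := taylor_lagrange _ _ v N df.
apply: (@le_trans _ _ (K * 2^-1 ^+ N)); last first.
  near: N; move/cvgrPdist_le : g0 => /(_ e e0); apply: filterS => N.
  by rewrite sub0r normrN; apply: le_trans; exact: ler_norm.
have {s01}[s0 s1] : 0 <= s /\ s <= 1.
  by move: s01; rewrite in_itv /= => /andP[/ltW -> /ltW ->].
have N2 : (N.+1%:R : R) <= 2 ^+ N by rewrite -natrX ler_nat ltn_expl.
have fC : 0 < (N`!%:R : R) by rewrite ltr0n fact_gt0.
rewrite !normrM normrX normfV normrM (ger0_norm (ltW fC)) (@ger0_norm _ (1 - s)) ?subr_ge0//.
have fN : `|f N.+1 (s * v)| <= K * C ^+ N.+1 * (N.+1)`!%:R.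
  apply: fb; rewrite normrM (ger0_norm s0) (le_trans _ v1)//.
  by rewrite ler_piMl.
apply: (@le_trans _ _ (`|v| * (K * C ^+ N.+1 * (N.+1)`!%:R) * (`|v| ^+ N / N`!%:R))).
  apply: ler_pM; rewrite ?mulr_ge0 ?invr_ge0 ?exprn_ge0 ?mulr_ge0 ?subr_ge0 ?(ltW fC)//.
    exact: ler_wpM2l.
  rewrite ler_wpM2r ?invr_ge0 ?(ltW fC)// lerXn2r ?nnegrE ?mulr_ge0 ?subr_ge0//.
  by rewrite ler_piMl// gerBl.
have -> : `|v| * (K * C ^+ N.+1 * (N.+1)`!%:R) * (`|v| ^+ N / N`!%:R) =
    K * ((C * `|v|) * N.+1%:R * (C * `|v|) ^+ N).
  rewrite factS natrM !exprMn exprS; move: (N`!%:R) fC (N.+1%:R) => a a0 b.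
  by field; rewrite gt_eqF.
apply: ler_wpM2l => //.
apply: (@le_trans _ _ (1 * 2 ^+ N * 4^-1 ^+ N)).
  apply: ler_pM; rewrite ?mulr_ge0 ?exprn_ge0 ?mulr_ge0 ?(ltW C0)//.
    apply: ler_pM; rewrite ?mulr_ge0 ?(ltW C0)//.
    by apply: le_trans vC _; lra.
  by rewrite lerXn2r ?nnegrE ?mulr_ge0 ?(ltW C0)// invr_ge0.
rewrite mul1r -exprMn (_ : 2 * 4^-1 = 2^-1 :> R)//; field.
Unshelve. all: by end_near. Qed.

(** * Touchard polynomials and their growth *)

(** An explicit witness for the identity by which [bell_poly] is chosen. *)
Definition touchard (R : nzRingType) (n : nat) : {poly R} :=
  iter n (fun p => 'X * (p + p^`())) 1.

Lemma size_touchard (R : nzRingType) (n : nat) : (size (touchard R n) <= n.+1)%N.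
Proof.
elim: n => [|n IH]; first by rewrite size_poly1.
rewrite /= -/(touchard R n) (leq_trans (size_polyMleq _ _))// size_polyX.
rewrite ltnS.
  rewrite (leq_trans (size_polyD _ _))// geq_max IH.
by rewrite (leq_trans (size_poly _ _))// (leq_trans (leq_pred _)).
Qed.

Lemma touchard_coef_ge0 (R : numDomainType) (n i : nat) : 0 <= (touchard R n)`_i.
Proof.
elim: n i => [|n IH] i; first by rewrite coef1 ler0n.
rewrite /= -/(touchard R n) coefXM; case: eqP => // _.
by rewrite coefD coef_deriv addr_ge0 ?mulrn_wge0.
Qed.

Lemma le_norm_horner (R : numDomainType) (p : {poly R}) (w M : R) :
  (forall i, 0 <= p`_i) -> `|w| <= M -> `|p.[w]| <= p.[M].
Proof.
move=> p0 wM; rewrite !horner_coef (le_trans (ler_norm_sum _ _ _))//.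
apply: ler_sum => i _; rewrite normrM normrX (ger0_norm (p0 _)).
by rewrite ler_wpM2l// lerXn2r// nnegrE (le_trans _ wM).
Qed.

(** For nonnegative coefficients and degree at most [n], [M p'(M) <= n p(M)]; so each step of the
    recurrence costs a factor at most [M + n <= (M + 1) (n + 1)]. *)
Lemma touchard_le (R : realDomainType) (M : R) (n : nat) : 0 <= M ->
  (touchard R n).[M] <= (M + 1) ^+ n * n`!%:R.
Proof.
move=> M0; elim: n => [|n IH]; first by rewrite hornerC mulr1 expr0.
have p0 := @touchard_coef_ge0 R n; have sp := size_touchard R n.
rewrite /= -/(touchard R n) hornerM hornerX hornerD.
set p := touchard R n in p0 sp IH *.
have pM0 : 0 <= p.[M].
  by rewrite horner_coef sumr_ge0// => i _; rewrite mulr_ge0// exprn_ge0.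
have dp : M * p^`().[M] <= n%:R * p.[M].
  have sdp : (size p^`() <= n)%N.
    by rewrite (leq_trans (size_poly _ _))//; case: (size p) sp.
  rewrite (horner_coef_wide _ sdp) (horner_coef_wide _ sp) big_ord_recl mulrDr.
  (* The constant term of [p] has no counterpart in the derivative; being nonnegative, it is
     dropped. *)
  apply: ler_wpDl; first by rewrite mulr_ge0// expr0 mulr1.
  rewrite !mulr_sumr; apply: ler_sum => i _.
  rewrite coef_deriv lift0 mulrCA -exprS -[_ *+ i.+1]mulr_natl -mulrA.
  by rewrite ler_wpM2r ?mulr_ge0 ?exprn_ge0// ler_nat.
rewrite mulrDr (le_trans (lerD (lexx _) dp))// -mulrDl.
rewrite exprS factS natrM mulrACA; apply: ler_pM => //; first exact: addr_ge0.
by have := mulr_ge0 M0 (ler0n R n); rewrite -natr1; lra.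
Qed.

(** With [w = z e^t], the polynomial factor contributes [w p'(w)] and the exponential factor
    [w p(w)], which together are the recurrence. *)
Lemma is_derive_touchard (R : realType) (z : R) (n : nat) (t : R) :
  is_derive t (1 : R)
    (fun t => (touchard R n).[z * expR t] * expR (z * (expR t - 1)))
    ((touchard R n.+1).[z * expR t] * expR (z * (expR t - 1))).
Proof.
have de : is_derive t 1 (fun t : R => z * expR t) (z * expR t).
  by apply: is_derive_eq; rewrite /GRing.scale /=; ring.
have dq : is_derive t 1 (fun t : R => z * (expR t - 1)) (z * expR t).
  by apply: is_derive_eq; rewrite /GRing.scale /=; ring.
have dp := @is_derive1_comp R (horner (touchard R n)) _ t _ _
  (is_derive_poly (touchard R n) (z * expR t)) de.
have dE := @is_derive1_comp R expR _ t _ _ (is_derive_expR _) dq.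
have dM := is_deriveM dp dE.
apply: is_derive_eq.
by rewrite /= hornerM hornerX hornerD /GRing.scale /=; ring.
Qed.

(** * The q-number identity and the Poisson moment generating function *)

Lemma qnum_invB (R : realType) (q x : R) : 0 < q -> q < 1 ->
  qnum q (1 - x) = 1 - qnum q^-1 x.
Proof.
move=> q0 q1; rewrite /qnum.
have qx : q `^ x != 0 by rewrite gt_eqF// powR_gt0.
rewrite -[q^-1]powR_inv1 ?ltW// -powRrM mulN1r powRN powR_inv1 ?ltW//.
rewrite powRB ?(gt_eqF q0) ?implybT// powRr1 ?ltW//.
have qn1 : 1 - q != 0 by rewrite subr_eq0 gt_eqF.
by field; rewrite qx gt_eqF//= mulN1r qn1 -oppr_eq0 opprB.
Qed.

(** The factor [e^(vk)] turns the Poisson weights into [e^(-alpha)] times the exponential series at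
    [alpha e^v]. *)
Lemma poisson_pmf_mgf_series (R : realType) (alpha v : R) : 0 < alpha ->
  (\sum_(k <oo) (expR (v * k%:R) * poisson_pmf alpha k)%:E =
   (expR (alpha * (expR v - 1)))%:E)%E.
Proof.
move=> a0; rewrite (_ : expR (alpha * (expR v - 1)) =
    expR (- alpha) * expR (alpha * expR v)); last first.
  by rewrite -expRD; congr expR; ring.
have c : cvgn (series (exp_coeff (alpha * expR v))).
  exact: is_cvg_series_exp_coeff.
rewrite EFinM.
under eq_eseriesr => k _.
  rewrite (_ : expR (v * k%:R) * poisson_pmf alpha k =
    expR (- alpha) * exp_coeff (alpha * expR v) k); last first.
    by rewrite /poisson_pmf a0 /exp_coeff/= exprMn expRM_natr; ring.
  rewrite EFinM; over.
rewrite nneseriesZl/=; last first.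
  by move=> k _; rewrite lee_fin exp_coeff_ge0// mulr_ge0// ltW// expR_gt0.
congr (_ * _)%E.
have -> : expR (alpha * expR v) = limn (series (exp_coeff (alpha * expR v))) by [].
by rewrite -EFin_lim//; apply/congr_lim/funext => N; rewrite /series/= sumEFin.
Qed.

(** [is_poisson] prescribes only the masses at the naturals. They add up to 1, so the rest of the
    space is null and the integral splits over the disjoint events [D k], where the integrand is
    constant. *)
Lemma mmt_gen_poisson d (T : measurableType d) (R : realType)
    (P : probability T R) (Y : {RV P >-> R}) (alpha v : R) :
  0 < alpha -> is_poisson Y alpha ->
  ('M_P Y v = (expR (alpha * (expR v - 1)))%:E)%E.
Proof.
move=> a0 hY; pose D k := Y @^-1` [set k%:R].
have mD k : measurable (D k) by exact: measurable_funPTI.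
have PD k : P (D k) = (poisson_pmf alpha k)%:E.
  by rewrite -hY /pmf fineK// fin_num_measure.
have tD : trivIset setT D.
  apply/trivIsetP => i j _ _ ij; apply/seteqP; split => // t [].
  by rewrite /D /= => -> /eqP; rewrite eqr_nat (negbTE ij).
have mU : measurable (\bigcup_k D k) by exact: bigcupT_measurable.
have PU : P (\bigcup_k D k) = 1%E.
  rewrite measure_bigcup// (eq_eseriesl _ _ (fun k => in_setT k)).
  (* The total mass is the moment series at [v = 0]. *)
  transitivity (\sum_(k <oo) (expR (0 * k%:R) * poisson_pmf alpha k)%:E)%E.
    by apply: eq_eseriesr => k _; rewrite mul0r expR0 mul1r; exact: PD.
  by rewrite poisson_pmf_mgf_series// expR0 subrr mulr0 expR0.
have PC : P (~` \bigcup_k D k) = 0%E by rewrite probability_setC// PU subee.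
have mf : measurable_fun [set: T] (EFin \o (fun t => expR (v * Y t))).
  apply/measurable_EFinP; apply: measurableT_comp => //.
  exact: measurable_funM.
rewrite /mmt_gen_fun unlock /comp /=.
under eq_integral do rewrite mulrC.
have f0 (t : T) : (0 <= (expR (v * Y t))%:E)%E by rewrite lee_fin expR_ge0.
rewrite (@ge0_negligible_integral _ _ _ _ _ (~` \bigcup_k D k))//; last exact: measurableC.
rewrite setTD setCK ge0_integral_bigcup//; last exact: measurable_funTS.
rewrite -poisson_pmf_mgf_series//; apply: eq_eseriesr => k _.
rewrite (eq_integral (cst (expR (v * k%:R))%:E)) ?integral_cst//.
  by rewrite EFinM; congr (_ * _)%E; exact: PD.
by move=> t; rewrite inE /D /= => ->.
Qed.

(** * The Bell generating function *)

Lemma is_egf_bell (R : realType) (z : R) :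
  is_egf 0 (fun n => (touchard R n).[z]) (fun v => expR (z * (expR v - 1))).
Proof.
pose f n t := (touchard R n).[z * expR t] * expR (z * (expR t - 1)).
have -> : (fun n => (touchard R n).[z]) = f ^~ 0.
  by apply/funext => n; rewrite /f expR0 subrr mulr0 expR0 !mulr1.
have -> : (fun v => expR (z * (expR v - 1))) = f 0%N.
  by apply/funext => t; rewrite /f hornerC mul1r.
pose M := `|z| * expR 1; have M0 : 0 <= M by rewrite mulr_ge0// expR_ge0.
(* For [|t| <= 1], [|z e^t| <= M] gives the rate [M + 1] through [touchard_le], and
   [|z (e^t - 1)| <= M + |z|] gives the constant. *)
apply: (@is_egf_derivatives R f (expR (M + `|z|)) (M + 1)).
- by rewrite lerDr.
- by move=> k t; exact: is_derive_touchard.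
move=> n t t1.
have zM : `|z * expR t| <= M.
  rewrite normrM (ger0_norm (expR_ge0 t)) ler_wpM2l// ler_expR.
  exact: le_trans (ler_norm t) t1.
rewrite /f normrM mulrC -mulrA; apply: ler_pM => //.
  rewrite ger0_norm ?expR_ge0// ler_expR (le_trans (ler_norm _))//.
  by rewrite mulrBr mulr1 (le_trans (ler_normB _ _))// lerD2r.
apply: le_trans (touchard_le _ _ n M0).
by apply: le_norm_horner => // i; exact: touchard_coef_ge0.
Qed.

(** As [touchard R] satisfies the defining identity, [xget] cannot fall back on its default. *)
Lemma bell_poly_egf (R : realType) (z : R) :
  is_egf 0 (fun n => (bell_poly R n).[z]) (fun v => expR (z * (expR v - 1))).
Proof.
rewrite /bell_poly; case: xgetP => [p _ /(_ z)//|/(_ (touchard R))].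
by case=> y; exact: is_egf_bell.
Qed.

(** * Uniqueness of the coefficients *)

(* Near v = 0 the tail of the series after the v^m term is O(v^(m+1)), so the
   first nonzero coefficient would force a nonzero sum. *)
Lemma powser_eq0 (R : realType) (a : nat -> R) :
  (\forall v \near (0 : R), (fun N => \sum_(0 <= n < N) a n * v ^+ n) @ \oo --> (0 : R)) ->
  forall n, a n = 0.
Proof.
move=> /nbhs_ballP[/= e e0 he]; pose v0 := e / 2.
have v00 : 0 < v0 by rewrite divr_gt0.
have cv v : `|v| < e -> (fun N => \sum_(0 <= n < N) a n * v ^+ n) @ \oo --> (0 : R).
  by move=> ve; apply: he; rewrite /ball /= sub0r normrN.
(* Convergence at [v0] makes the terms tend to 0, hence bounded. *)
have [B B0 hB] : exists2 B, 0 <= B & forall n, `|a n| * v0 ^+ n <= B.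
  have v0e : `|v0| < e by rewrite gtr0_norm// /v0; lra.
  have := cvg_series_cvg_0 (cvgP _ (cv _ v0e)) => /cvgP/cvg_seq_bounded.
  move=> [B [Br hB]]; exists (`|B| + 1); first by rewrite addr_ge0.
  move=> n; have := hB (`|B| + 1); rewrite (le_lt_trans (ler_norm B)) ?ltrDl//.
  by move=> /(_ isT n I); rewrite /= normrM normrX (gtr0_norm v00).
move=> n; elim/ltn_ind: n => m IH.
apply/eqP; rewrite -normr_eq0 eq_le normr_ge0 andbT.
have key v : 0 < v -> v <= v0 / 2 -> `|a m| <= v * (2 * B / v0 ^+ m.+1).
  move=> vgt0 vv0; have ve : `|v| < e by rewrite gtr0_norm// /v0 in vv0 *; lra.
  pose t := v / v0.
  have t0 : 0 < t by rewrite divr_gt0.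
  have t2 : t <= 2^-1 by rewrite ler_pdivrMr// mulrC.
  have ak k : `|a k * v ^+ k| <= B * t ^+ k.
    rewrite normrM normrX (gtr0_norm vgt0) -(divfK (lt0r_neq0 v00) v) -/t.
    by rewrite exprMn [t ^+ k * _]mulrC mulrA ler_wpM2r// exprn_ge0// ltW.
  (* The last factor is the geometric sum [1 + 1/2 + ...] of [N] terms, which suffices because
     [t <= 1/2]. *)
  have tail N : `|\sum_(0 <= n < N) a (n + m.+1)%N * v ^+ (n + m.+1)| <=
      B * t ^+ m.+1 * (2 - 2 * 2^-1 ^+ N).
    elim: N => [|N IHN]; first by rewrite big_geq// normr0 expr0 mulr1 subrr mulr0.
    rewrite big_nat_recr//= (le_trans (ler_normD _ _))//.
    apply: (le_trans (lerD IHN (ak _))).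
    rewrite exprD.
    have := @lerXn2r R N t 2^-1.
    rewrite !nnegrE (ltW t0) invr_ge0 ler0n t2 => /(_ isT isT isT) tN.
    have BT : 0 <= B * t ^+ m.+1 by rewrite mulr_ge0// exprn_ge0// ltW.
    have := ler_wpM2l BT tN; rewrite [2^-1 ^+ N.+1]exprS; lra.
  have {}tail : `|a m| * v ^+ m <= B * t ^+ m.+1 * 2.
    (* A partial sum within [d] of 0 splits into the terms below [m], zero by induction, the term
       [m], and the tail. *)
    apply/ler_addgt0Pr => d d0.
    have /cvgrPdist_le/(_ d d0)[N _ hN] := cv v ve.
    have := hN (N + m.+1)%N; rewrite /= leq_addr sub0r normrN => /(_ isT).
    rewrite (@big_cat_nat _ _ _ m.+1)//= ?leq_addl// big_nat_recr//=.
    rewrite big_nat_cond big1 ?add0r; last first.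
      by move=> i; rewrite andbT => /andP[_ im]; rewrite IH// mul0r.
    rewrite -{1}[m.+1]add0n big_addn addnK => hd.
    have -> : `|a m| * v ^+ m = `|a m * v ^+ m|.
      by rewrite normrM normrX (gtr0_norm vgt0).
    set S := \sum_(_ <= _ < _) _ in hd.
    rewrite -(addrK S (a m * v ^+ m)) (le_trans (ler_normB _ _))// addrC lerD//.
    apply: (le_trans (tail N)); rewrite ler_wpM2l//.
      by rewrite mulr_ge0// exprn_ge0// ltW.
    by rewrite gerBl mulr_ge0// exprn_ge0// invr_ge0.
  rewrite -(@ler_pM2r _ (v ^+ m)) ?exprn_gt0// (le_trans tail)//.
  rewrite /t expr_div_n !exprS; have := exprn_gt0 m v00.
  move: (v ^+ m) (v0 ^+ m) => x y y0.
  by rewrite le_eqVlt; apply/orP; left; apply/eqP; field; rewrite !gt_eqF.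
pose D := 2 * B / v0 ^+ m.+1.
have D0 : 0 <= D by rewrite mulr_ge0 ?mulr_ge0// invr_ge0 exprn_ge0// ltW.
apply/ler_addgt0Pr => d d0; rewrite add0r.
have D1 : 0 < D + 1 by rewrite ltr_wpDl.
(* The second bound gives [v * D <= d]; [D + 1] avoids a division by 0 when [D = 0]. *)
pose v := Num.min (v0 / 2) (d / (D + 1)).
apply: (@le_trans _ _ (v * D)).
  by apply: key; [rewrite lt_min !divr_gt0|rewrite ge_min lexx].
apply: (@le_trans _ _ (d / (D + 1) * D)).
  by rewrite ler_wpM2r// ge_min lexx orbT.
by rewrite mulrAC ler_pdivrMr// ler_pM2l// lerDl.
Qed.

(** The differences of the coefficients over [k!], set to 0 below [r], form a power series with sum
    0 near 0. *)
Lemma is_egf_uniq (R : realType) (r : nat) (c c' : nat -> R) (f : R -> R) :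
  is_egf r c f -> is_egf r c' f -> forall n, (r <= n)%N -> c n = c' n.
Proof.
move=> hc hc' n rn.
pose a k : R := if (r <= k)%N then (c k - c' k) / k`!%:R else 0.
suff : a n = 0.
  rewrite /a rn => /eqP; rewrite mulf_eq0 invr_eq0 pnatr_eq0.
  by rewrite (gtn_eqF (fact_gt0 n)) orbF subr_eq0 => /eqP.
apply: powser_eq0; near=> v.
have cv : (fun N => \sum_(r <= k < N) c k * (v ^+ k / k`!%:R)) @ \oo --> f v.
  by near: v.
have cv' : (fun N => \sum_(r <= k < N) c' k * (v ^+ k / k`!%:R)) @ \oo --> f v.
  by near: v.
rewrite -[X in _ --> X](subrr (f v)); apply: (cvg_trans _ (cvgB cv cv')).
apply: near_eq_cvg; near=> N.
have rN : (r <= N)%N by near: N; exact: nbhs_infty_ge.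
rewrite !fctE -sumrB (@big_cat_nat _ _ _ r 0 N)//= [X in _ = X + _]big1_seq ?add0r.
  rewrite big_nat_cond [in RHS]big_nat_cond; apply: eq_bigr => k.
  by rewrite andbT => /andP[rk _]; rewrite /a rk; ring.
move=> k /=; rewrite mem_index_iota => /andP[_ kr].
by rewrite /a leqNgt kr mul0r.
Unshelve. all: by end_near. Qed.

(** * Shift by the monomial factor, and conclusion *)

(** Termwise, [v^r / r! * v^k / k! = 'C(k + r, r) * v^(k + r) / (k + r)!]. *)
Lemma is_egf_shift (R : realType) (r : nat) (b : R) (c : nat -> R) (f : R -> R) :
  is_egf 0 c f ->
  is_egf r (fun n => 'C(n, r)%:R * b ^+ r * c (n - r)%N)
    (fun v => (v * b) ^+ r / r`!%:R * f v).
Proof.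
rewrite /is_egf => h; near=> v.
have cv : (fun N => \sum_(0 <= k < N) c k * (v ^+ k / k`!%:R)) @ \oo --> f v.
  by near: v.
rewrite -(cvg_shiftn r (fun N => \sum_(r <= n < N) _)).
rewrite (_ : [sequence _]_n = (fun n => (v * b) ^+ r / r`!%:R *
    \sum_(0 <= k < n) c k * (v ^+ k / k`!%:R))); first exact: cvgMl_tmp cv.
apply/funext => N; rewrite /= -[X in \sum_(X <= _ < _) _]add0n big_addn addnK mulr_sumr.
apply: eq_bigr => k _; rewrite addnK exprD exprMn.
have : ('C(k + r, r)%:R * (r`!%:R * k`!%:R) : R) = (k + r)`!%:R.
  by rewrite -!natrM -(@bin_fact (k + r) r) ?leq_addl// addnK.
have : (r`!%:R : R) != 0 by rewrite pnatr_eq0 -lt0n fact_gt0.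
have : (k`!%:R : R) != 0 by rewrite pnatr_eq0 -lt0n fact_gt0.
move: (r`!%:R : R) (k`!%:R : R) ((k + r)`!%:R : R) => x y z y0 x0 zE.
rewrite -zE; field; rewrite y0 x0 /=.
by rewrite pnatr_eq0 -lt0n bin_gt0 leq_addl.
Unshelve. all: by end_near. Qed.

Theorem theorem3p1 (d : measure_display) (T : measurableType d) (R : realType)
    (P : probability T R) (Y : {RV P >-> R}) (alpha q x : R) (n r : nat)
    (halpha : 0 < alpha) (hY : is_poisson Y alpha)
    (hq0 : 0 < q) (hq1 : q < 1) (hx0 : 0 <= x) (hx1 : x <= 1)
    (hrn : (r <= n)%N) :
  prob_qbernstein P Y r n x q =
  'C(n, r)%:R * qnum q x ^+ r * (bell_poly R (n - r)).[alpha * (1 - qnum q^-1 x)].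
Proof.
have gen : is_egf r
    (fun n => 'C(n, r)%:R * qnum q x ^+ r *
       (bell_poly R (n - r)).[alpha * (1 - qnum q^-1 x)])
    (bernstein_gen P Y r x q).
  have := is_egf_shift _ r (qnum q x) _ _ (bell_poly_egf _ (alpha * (1 - qnum q^-1 x))).
  congr is_egf; apply/funext => v; rewrite /bernstein_gen.
  (* The moment generating function is an exponential, so the real power multiplies its exponent by
     [[1-x]_q]. *)
  rewrite (mmt_gen_poisson _ _ _ _ _ _ _ halpha hY) /=.
  by rewrite -expRM qnum_invB//; congr (_ * expR _); ring.
(* [gen] excludes the default of [xget]; the chosen sequence is determined from index [r] on, whence
   [hrn]. *)
rewrite /prob_qbernstein; case: xgetP => [c _ hc|/(_ _ gen)//].
exact: (is_egf_uniq _ _ _ _ _ hc gen n hrn).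
Qed.
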